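(* Let $N\ge 3$ be odd, let $M$ be a compact connected oriented $3$-manifold with non-empty boundary made of tori, let $\mathcal T=(T,\tilde b,w,f,c)$ be a QH triangulation encoding a tuple $(M,\rho,h,k)$, with underlying pre-branching $\omega=\omega_{\tilde b}$, and let $c_0$ be a charge on $T$ encoding a pair of $c$-weights $(h_c^0,k_c^0)$. The value of $\alpha_{N,c_0}(\mathcal T)$ does not depend on the choice of $\tilde b$ among the weak branchings compatible with $\omega$ (i.e. inducing $\omega$), and it does not depend on the choice of the tuple $(w,c,f)$ and charge $c_0$ encoding $(\rho,h,k)$ and $(h_c^0,k_c^0)$ up to multiplication by $4$-th roots of $1$. Moreover, as a function of $(\rho,h,k)$ and $(h_c^0,k_c^0)$ it depends only on $k_f$ and $k_c-k_c^0$.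
   Context: **Triangulations.** $\hat M$ is obtained from $M$ by collapsing each component of $\partial M$ to a point. An ideal triangulation $T$ of $\hat M$ is a finite collection of oriented (abstract) tetrahedra with a complete system of pairings of their $2$-faces by orientation-reversing affine isomorphisms (self- and multiple adjacencies allowed), together with an orientation-preserving piecewise smooth homeomorphism of the quotient onto $\hat M$, whose vertex set is exactly $\hat M\setminus \mathrm{Int}(M)$. An abstract edge is an edge of a tetrahedron before gluing; it is ''around'' the edge $e$ of $T$ if it is glued to $e$. A pre-branching $\omega$ of $T$ assigns to every $2$-face of $T$ a transverse co-orientation so that every abstract tetrahedron has two ingoing and two outgoing faces. **Weak branchings.** A branching $b$ of an oriented tetrahedron $\Delta$ is an ordering $v_0,v_1,v_2,v_3$ of its vertices; $F_j$ is the face opposite to $v_j$; $*_b=1$ if the ordering gives the orientation of $\Delta$ and $*_b=-1$ otherwise. It induces a pre-branching of $\Delta$: if $*_b=1$ the faces $F_0,F_2$ are outgoing and $F_1,F_3$ ingoing, if $*_b=-1$ the opposite. A weak branching $\tilde b$ of $T$ is a choice of branching on each tetrahedron such that the induced face co-orientations match and give a pre-branching $\omega_{\tilde b}$ of $T$. **QH triangulations.** A QH triangulation $\mathcal T=(T,\tilde b,w,f,c)$ is a weakly branched ideal triangulation with, on each branched tetrahedron $(\Delta,b)$, triples $(w_j,f_j,c_j)$, $j=0,1,2$, where index $0$ labels $[v_0,v_1]$, index $1$ labels $[v_1,v_2]$, index $2$ labels $[v_0,v_2]$ and opposite edges have equal labels, such that: $w_j\in\mathbb C\setminus\{0,1\}$,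 $w_{j+1}=(1-w_j)^{-1}$ (indices mod $3$); $f_j\in\mathbb Z$ and the log branches $l_j=\log(w_j)+\pi i f_j$ satisfy $l_0+l_1+l_2=0$; $c_j\in\mathbb Z$, $c_0+c_1+c_2=1$. Moreover at every edge $e$ of $T$: the product of the signed shape parameters $w^{*_b}$ of the abstract edges around $e$ is $1$; the sum of the signed log branches $*_b l$ around $e$ is $0$; the sum of the charges $c$ around $e$ is $2$. A system $c$ satisfying the conditions stated for $c$ is called a charge on $T$. When $\tilde b$ is changed to another weak branching inducing the same $\omega$, the decoration is rewritten so that on each abstract edge $w^{*_b}$, $*_bf$ and $c$ are unchanged. **Encoded data.** $\rho$ is the conjugacy class of representations $\pi_1(M)\to PSL(2,\mathbb C)$ given by the (Thurston) holonomy of the system of signed shape parameters. The weights $h=(h_f,h_c)\in H^1(M;\mathbb Z/2)^2$, $k=(k_f,k_c)\in H^1(\partial M;\mathbb C)\times H^1(\partial M;\mathbb Z)$ are as follows. Let $\partial T$ be the triangulation of $\partial M$ by the truncation triangles of the tetrahedra. Represent classes of $H_1(\partial M;\mathbb Z)$ by normal loops $C$ (disjoint unions of oriented simple closed curves transverse to $\partial T$, never entering and leaving a triangle by the same edge). For a vertex $v$ of a triangle, $E_v$ is the abstract edge containing $v$, $*_v$ the branching sign of its tetrahedron, and $ind(C,v)$ is the number of subarcs of $C$ turning around $v$ in the triangle, counted with sign $+$ if oriented as the orientation of $\partial M$ seen from $v$ and $-$ otherwise. Then $k_c([C])=\sum ind(C,v)\,c(E_v)$ and $k_f([C])=\sum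 *_v\, ind(C,v)\, l(E_v)$. For a loop in $M$ transverse to the $2$-faces and entering and leaving each tetrahedron by distinct faces, $h_c$ (resp. $h_f$) is the sum mod $2$ of the charges (resp. flattenings) of the edges common to the entrance and exit faces. The weights $(h_c^0,k_c^0)$ are computed from $c_0$ as $(h_c,k_c)$ from $c$. **Normalized symmetrization factor.** On each tetrahedron put $\mathbf w_k=\exp\big(\frac{\log(w_k)+\pi i(N+1)(f_k-*_bc_k)}{N}\big)$, and let $\alpha_N(\mathcal T)=\prod_\Delta(\mathbf w_0^{-c_1}\mathbf w_1^{c_0})^{\frac{N-1}{2}}$ (here $c_0,c_1$ are the charge entries of $\Delta$). For a charge $c_0$ on $T$, $\mathcal T_{c_0}$ denotes $\mathcal T$ with $c$ replaced by $c_0$, and $\alpha_{N,c_0}(\mathcal T):=\alpha_N(\mathcal T)/\alpha_N(\mathcal T_{c_0})$.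
   Formalization: Independence of the weak branching is stated when the rewritten decoration is again a QH triangulation; with a negative real shape on a tetrahedron whose sign changes, keeping the signed flattenings breaks l_0+l_1+l_2=0 and the claim can fail. *)

(* Defs.v *)
From HB Require Import structures.
From mathcomp Require Import all_boot all_order all_algebra all_fingroup.
From mathcomp Require Import reals sequences exp trigo.
From mathcomp Require Import complex.

Set Implicit Arguments.
Unset Strict Implicit.
Unset Printing Implicit Defensive.

Import Order.TTheory GRing.Theory Num.Theory.
Local Open Scope ring_scope.
Local Open Scope complex_scope.

Section ComplexLog.
Variable R : realType.

Definition Cmod (z : R[i]) : R :=
  Num.sqrt (complex.Re z ^+ 2 + complex.Im z ^+ 2).

(* The principal argument, with values in ]-pi, pi]. *)
Definition Carg (z : R[i]) : R :=
  let t := acos (complex.Re z / Cmod z) in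
  if 0 <= complex.Im z then t else - t.

Definition Clog (z : R[i]) : R[i] := ln (Cmod z) +i* Carg z.

Definition Cexp (z : R[i]) : R[i] :=
  (expR (complex.Re z) * cos (complex.Im z))
    +i* (expR (complex.Re z) * sin (complex.Im z)).

Definition pi_i : R[i] := 0 +i* pi.

End ComplexLog.
Arguments pi_i {R}.

(* The vertices of every oriented abstract tetrahedron are named by 'I_4 in
   such a way that the order 0, 1, 2, 3 gives its orientation; face [i] is the
   face opposite to vertex [i].  Face [i] of [d] is glued to face [glue d i i]
   of [nbr d i], its vertex [v != i] being sent to [glue d i v].  An affine
   isomorphism of faces reverses the boundary orientations exactly when its
   extension to all vertices by [i |-> glue d i i] is an odd permutation. *)
Record gluing := Gluing {
  tet : finType;
  nbr : tet -> 'I_4 -> tet;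
  glue : tet -> 'I_4 -> 'S_4;
  nbrK : forall d i, nbr (nbr d i) (glue d i i) = d;
  glueK : forall d i, glue (nbr d i) (glue d i i) = ((glue d i)^-1)%g;
  glue_odd : forall d i, odd_perm (glue d i);
  glue_neq : forall d i, (nbr d i, glue d i i) != (d, i)
}.
Arguments nbr {g}.
Arguments glue {g}.

Section Cells.
Variable T : gluing.

(* A truncation triangle is a corner (d, u): tetrahedron and vertex.  Its
   vertices lie on the abstract edges {u, v}, v != u, and its sides on the
   faces i != u. *)
Definition tri : finType := (tet T * 'I_4)%type.

Definition tri_adj (x y : tri) : bool :=
  [exists i, (i != x.2) && (y == (nbr x.1 i, glue x.1 i x.2))].

(* ((d, u), v) is the vertex of the triangle (d, u) lying on the edge {u, v}. *)
Definition vertex_adj (x y : tri * 'I_4) : bool :=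
  [exists i, [&& i != x.1.2, i != x.2 &
    y == ((nbr x.1.1 i, glue x.1.1 i x.1.2), glue x.1.1 i x.2)]].

(* ((d, u), i) is the side of the triangle (d, u) lying on the face i. *)
Definition side_adj (x y : tri * 'I_4) : bool :=
  let g := glue x.1.1 x.2 in
  y == ((nbr x.1.1 x.2, g x.1.2), g x.2).

(* The component of the boundary triangulation containing the triangle x. *)
Definition link (x : tri) : pred tri := connect tri_adj x.

Definition link_flags (x : tri) : pred (tri * 'I_4) :=
  [pred y | (y.2 != y.1.2) && link x y.1].

Definition link_euler (x : tri) : int :=
  (n_comp vertex_adj (link_flags x))%:Z
  - (n_comp side_adj (link_flags x))%:Z + #|link x|%:Z.

(* An abstract edge is (d, A) with A the pair of its endpoints, #|A| = 2. *)
Definition aedge : finType := (tet T * {set 'I_4})%type.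

Definition edge_adj (x y : aedge) : bool :=
  [exists i, (i \notin x.2) && (y == (nbr x.1 i, [set glue x.1 i v | v in x.2]))].

(* The abstract edges y around the edge of T to which x is glued. *)
Definition around (x : aedge) : pred aedge :=
  connect edge_adj x.

End Cells.

(* The manifold M is the union of the glued truncated tetrahedra; the orientation
   of the tetrahedra is inherited by M, the boundary components are the links,
   and these closed oriented surfaces are tori iff their Euler characteristic
   vanishes. *)
Record ideal_triangulation := IdealTriangulation {
  itri :> gluing;
  itri_nonempty : (0 < #|tet itri|)%N;
  itri_connected : forall d d' : tet itri,
    connect (fun e e' => [exists i, nbr e i == e']) d d';
  itri_tori : forall x : tri itri, link_euler x = 0
}.

(* A branching s : 'S_4 of a tetrahedron lists its vertices as
   v_0 = s 0, ..., v_3 = s 3. *)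
Definition bsign (s : 'S_4) : int := (-1) ^+ odd_perm s.

(* Face F_j is outgoing iff j is even and *_b = 1, or j is odd and *_b = -1. *)
Definition outgoing (s : 'S_4) (i : 'I_4) : bool :=
  ~~ odd ((s^-1)%g i) (+) odd_perm s.

(* The index in {0, 1, 2} of the edge A of a branched tetrahedron: [v0, v1] and
   [v2, v3] have index 0, [v1, v2] and [v0, v3] index 1, [v0, v2] and [v1, v3]
   index 2.  It is determined by the sum of the positions of the endpoints. *)
Definition edge_label (s : 'S_4) (A : {set 'I_4}) : 'I_3 :=
  let m := (\sum_(v in A) (s^-1)%g v)%N in
  if (m == 1%N) || (m == 5%N) then 0 else if m == 3%N then 1 else 2.

Section Branchings.
Variable T : gluing.

(* om d i = true means that the co-orientation of face i goes out of d. *)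
Definition pre_branching (om : tet T -> 'I_4 -> bool) : Prop :=
  (forall d i, om (nbr d i) (glue d i i) = ~~ om d i) /\
  (forall d, #|[set i | om d i]| = 2%N).

Definition induced (b : tet T -> 'S_4) : tet T -> 'I_4 -> bool :=
  fun d => outgoing (b d).

Definition weak_branching (b : tet T -> 'S_4) : Prop :=
  pre_branching (induced b).

(* Value on the abstract edge (d, A) of a decoration indexed by labels. *)
Definition on_edge (X : Type) (b : tet T -> 'S_4) (x : tet T -> 'I_3 -> X)
  (d : tet T) (A : {set 'I_4}) : X := x d (edge_label (b d) A).

Definition charge (b : tet T -> 'S_4) (c : tet T -> 'I_3 -> int) : Prop :=
  (forall d, c d 0 + c d 1 + c d 2 = 1) /\
  (forall x : aedge T, #|x.2| = 2%N -> \sum_(y | around x y) on_edge b c y.1 y.2 = 2).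

End Branchings.

Section QH.
Variables (R : realType) (T : gluing).

Definition logb (w : tet T -> 'I_3 -> R[i]) (f : tet T -> 'I_3 -> int)
  (d : tet T) (j : 'I_3) : R[i] := Clog (w d j) + pi_i * (f d j)%:~R.

Definition sshape (b : tet T -> 'S_4) (w : tet T -> 'I_3 -> R[i])
  (d : tet T) (A : {set 'I_4}) : R[i] := on_edge b w d A ^ bsign (b d).

Definition sflat (b : tet T -> 'S_4) (f : tet T -> 'I_3 -> int)
  (d : tet T) (A : {set 'I_4}) : int := bsign (b d) * on_edge b f d A.

Definition slogb (b : tet T -> 'S_4) (w : tet T -> 'I_3 -> R[i])
  (f : tet T -> 'I_3 -> int) (d : tet T) (A : {set 'I_4}) : R[i] :=
  (bsign (b d))%:~R * on_edge b (logb w f) d A.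

End QH.

(* Addition in 'I_3 is modulo 3. *)
Record QH_triangulation (R : realType) (T : gluing) := QHTriangulation {
  br : tet T -> 'S_4;
  wq : tet T -> 'I_3 -> R[i];
  fq : tet T -> 'I_3 -> int;
  cq : tet T -> 'I_3 -> int;
  br_weak : weak_branching br;
  wq_neq : forall d j, wq d j != 0 /\ wq d j != 1;
  wq_succ : forall d j, wq d (j + 1) = (1 - wq d j)^-1;
  fq_sum : forall d, logb wq fq d 0 + logb wq fq d 1 + logb wq fq d 2 = 0;
  cq_charge : charge br cq;
  wq_edge : forall x : aedge T, #|x.2| = 2%N ->
    \prod_(y | around x y) sshape br wq y.1 y.2 = 1;
  fq_edge : forall x : aedge T, #|x.2| = 2%N ->
    \sum_(y | around x y) slogb br wq fq y.1 y.2 = 0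
}.

(* The decoration of Q rewritten for the weak branching of Q', which is meant to
   induce the same pre-branching. *)
Definition rewritten (R : realType) (T : gluing) (Q Q' : QH_triangulation R T) :
  Prop :=
  forall d (A : {set 'I_4}), #|A| = 2%N ->
    [/\ sshape (br Q') (wq Q') d A = sshape (br Q) (wq Q) d A,
        sflat (br Q') (fq Q') d A = sflat (br Q) (fq Q) d A &
        on_edge (br Q') (cq Q') d A = on_edge (br Q) (cq Q) d A].

Definition rewritten_charge (T : gluing) (b b' : tet T -> 'S_4)
  (c c' : tet T -> 'I_3 -> int) : Prop :=
  forall d (A : {set 'I_4}), #|A| = 2%N -> on_edge b' c' d A = on_edge b c d A.

(* Paths transverse to the faces, starting in a tetrahedron, are given by the
   successive faces through which they leave the tetrahedra they visit.  The
   fundamental group of M is that of the 2-complex dual to T: loops up to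
   backtracking and up to turning around the edges of T. *)

Section FundamentalGroup.
Variable T : gluing.

Fixpoint walk (d : tet T) (p : seq 'I_4) : tet T :=
  if p is i :: q then walk (nbr d i) q else d.

(* In state (d, (i, j)) one has entered d by face i and leaves it by face j,
   turning around the edge common to these faces. *)
Definition turn (x : tet T * ('I_4 * 'I_4)) : tet T * ('I_4 * 'I_4) :=
  let: (d, (i, j)) := x in (nbr d j, (glue d j j, glue d j i)).

Definition edge_loop (d : tet T) (e : seq 'I_4) : Prop :=
  exists n (i j : 'I_4), [/\ i != j, iter n turn (d, (i, j)) = (d, (i, j)) &
    e = [seq x.2.2 | x <- traject turn (d, (i, j)) n]].

End FundamentalGroup.

Section Holonomy.
Variables (R : realType) (T : gluing) (d0 : tet T).
Implicit Types r : seq 'I_4 -> 'M[R[i]]_2.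

Definition PSL_eq (A B : 'M[R[i]]_2) : Prop := A = B \/ A = - B.

(* Only the values of r on the loops based at d0 are meaningful. *)
Definition PSL_representation r : Prop :=
  [/\ forall p, walk d0 p = d0 -> \det (r p) = 1,
      forall p q, walk d0 p = d0 -> walk d0 q = d0 ->
        PSL_eq (r (p ++ q)) (r p *m r q),
      forall p i q, let d := walk d0 p in
        walk d q = d0 ->
        PSL_eq (r (p ++ [:: i; glue d i i] ++ q)) (r (p ++ q)) &
      forall p e q, let d := walk d0 p in
        walk d q = d0 -> edge_loop d e ->
        PSL_eq (r (p ++ e ++ q)) (r (p ++ q))].

(* Points of the projective line are nonzero column vectors up to scalars. *)
Definition brk (x y : 'cV[R[i]]_2) : R[i] := \det (row_mx x y : 'M_(2, 1 + 1)).

Definition same_point (x y : 'cV[R[i]]_2) : Prop := brk x y = 0.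

(* (x2 - x1) (x3 - x0) / ((x2 - x0) (x3 - x1)), i.e. z for (0, oo, 1, z). *)
Definition cross_ratio (x : 'I_4 -> 'cV[R[i]]_2) : R[i] :=
  (brk (x 2) (x 1) * brk (x 3) (x 0)) / (brk (x 2) (x 0) * brk (x 3) (x 1)).

(* r is in the conjugacy class of the holonomy of the shape parameters z on the
   abstract edges: there is a developing map dev, associating to each path p
   from d0 an ideal tetrahedron with vertices dev p v, which is r-equivariant. *)
Definition holonomy (z : tet T -> {set 'I_4} -> R[i]) r : Prop :=
  PSL_representation r /\
  exists dev : seq 'I_4 -> 'I_4 -> 'cV[R[i]]_2,
    [/\ forall p v, dev p v != 0,
        forall p u v, u != v -> ~ same_point (dev p u) (dev p v),
        forall p (s : 'S_4), ~~ odd_perm s ->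
          cross_ratio (fun j => dev p (s j)) = z (walk d0 p) [set s 0; s 1],
        forall p i v, v != i ->
          same_point (dev (rcons p i) (glue (walk d0 p) i v)) (dev p v) &
        forall p q v, walk d0 p = d0 ->
          same_point (dev (p ++ q) v) (r p *m dev q v)].

Definition same_rho (Q Q' : QH_triangulation R T) : Prop :=
  forall r, holonomy (sshape (br Q) (wq Q)) r <->
            holonomy (sshape (br Q') (wq Q')) r.

End Holonomy.

Section Loops.
Variable T : gluing.

(* (d, (i, j)): passage through d from the entrance face i to the exit face j. *)
Definition passage : Type := (tet T * ('I_4 * 'I_4))%type.

Definition next_passage : rel passage := fun x y =>
  (y.1 == nbr x.1 x.2.2) && (y.2.1 == glue x.1 x.2.2 x.2.2).

Definition M_loop (p : seq passage) : bool :=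
  path.cycle next_passage p && all (fun x => x.2.1 != x.2.2) p.

Definition common_edge (i j : 'I_4) : {set 'I_4} := ~: [set i; j].

(* (d, s): oriented arc in the truncation triangle at vertex s 0 of d, entering
   by the side on face s 2, leaving by the side on face s 3, hence turning
   around the vertex of the triangle on the abstract edge [s 0, s 1].  If s is
   even, (s 0, s 1, s 2, s 3) is a positive ordering of the vertices of d, and
   the arc is then positive for the orientation of the boundary of M given by
   the outward normal. *)
Definition arc : Type := (tet T * 'S_4)%type.

Definition arc_tri (a : arc) : tri T := (a.1, a.2 0).

Definition arc_edge (a : arc) : {set 'I_4} := [set a.2 0; a.2 1].

Definition next_arc : rel arc := fun a a' =>
  let g := glue a.1 (a.2 3) in
  [&& a'.1 == nbr a.1 (a.2 3), a'.2 0 == g (a.2 0) & a'.2 2 == g (a.2 3)].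

(* Oriented closed normal curves going at most once through each triangle; they
   are simple, and their classes generate H_1(bd M; Z), so that two classes in
   H^1(bd M) coincide iff they agree on them. *)
Definition normal_loop (C : seq arc) : bool :=
  path.cycle next_arc C && uniq (map arc_tri C).

Variable b : tet T -> 'S_4.

(* h_c, and h_f when c is replaced by f. *)
Definition weight_h (c : tet T -> 'I_3 -> int) (p : seq passage) : 'F_2 :=
  (\sum_(x <- p) on_edge b c x.1 (common_edge x.2.1 x.2.2))%:~R.

Definition weight_kc (c : tet T -> 'I_3 -> int) (C : seq arc) : int :=
  \sum_(a <- C) bsign a.2 * on_edge b c a.1 (arc_edge a).

Definition weight_kf (R : realType) (w : tet T -> 'I_3 -> R[i])
  (f : tet T -> 'I_3 -> int) (C : seq arc) : R[i] :=
  \sum_(a <- C) (bsign a.2)%:~R * slogb b w f a.1 (arc_edge a).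

End Loops.

Section SameWeights.
Variables (R : realType) (T : gluing).
Implicit Types (Q : QH_triangulation R T) (b : tet T -> 'S_4)
  (c : tet T -> 'I_3 -> int).

Definition same_kf Q Q' : Prop := forall C : seq (arc T), normal_loop C ->
  weight_kf (br Q) (wq Q) (fq Q) C = weight_kf (br Q') (wq Q') (fq Q') C.

Definition same_hf Q Q' : Prop := forall p : seq (passage T), M_loop p ->
  weight_h (br Q) (fq Q) p = weight_h (br Q') (fq Q') p.

Definition same_hc b c b' c' : Prop := forall p : seq (passage T), M_loop p ->
  weight_h b c p = weight_h b' c' p.

Definition same_kc b c b' c' : Prop := forall C : seq (arc T), normal_loop C ->
  weight_kc b c C = weight_kc b' c' C.

Definition same_kc_diff b c c0 b' c' c0' : Prop :=
  forall C : seq (arc T), normal_loop C ->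
  weight_kc b c C - weight_kc b c0 C = weight_kc b' c' C - weight_kc b' c0' C.

Definition same_encoding (d0 : tet T) Q Q' : Prop :=
  [/\ same_rho d0 Q Q',
      same_hf Q Q' /\ same_hc (br Q) (cq Q) (br Q') (cq Q') &
      same_kf Q Q' /\ same_kc (br Q) (cq Q) (br Q') (cq Q')].

Definition same_c_weights b c b' c' : Prop :=
  same_hc b c b' c' /\ same_kc b c b' c'.

End SameWeights.

Section Alpha.
Variables (R : realType) (T : gluing) (N : nat) (b : tet T -> 'S_4)
  (w : tet T -> 'I_3 -> R[i]) (f : tet T -> 'I_3 -> int).

Definition wroot (c : tet T -> 'I_3 -> int) (d : tet T) (k : 'I_3) : R[i] :=
  Cexp ((Clog (w d k)
         + pi_i * N.+1%:R * (f d k - bsign (b d) * c d k)%:~R) / N%:R).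

Definition alpha (c : tet T -> 'I_3 -> int) : R[i] :=
  \prod_(d : tet T)
    (wroot c d 0 ^ (- c d 1) * wroot c d 1 ^ c d 0) ^+ (N.-1)./2.

End Alpha.

Definition alpha_rel (R : realType) (T : gluing) (N : nat)
  (Q : QH_triangulation R T) (c0 : tet T -> 'I_3 -> int) : R[i] :=
  alpha N (br Q) (wq Q) (fq Q) (cq Q) / alpha N (br Q) (wq Q) (fq Q) c0.

(* Main.v *)
Require Import Defs.
From mathcomp Require Import all_boot all_order all_algebra all_fingroup.
From mathcomp Require Import reals complex.
From mathcomp Require Import exp trigo ring zify.
Import GRing.Theory Num.Theory.
Local Open Scope ring_scope.
Set Implicit Arguments.
Unset Strict Implicit.
Unset Printing Implicit Defensive.
Import Order.TTheory.
Local Open Scope complex_scope.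

(** Write [l] for the log branches, [*l] for the signed ones and [delta = c - c0]
    for the difference of the two charges.  Since [N + 1] is congruent to 1
    modulo [N], the symmetrization factor is the exponential of a bilinear
    expression ([alphaE]), and the normalized one is, up to the sign
    [exp (pi i k)] with [k] an integer,
      [exp ((N - 1) / (2 N) * omega (delta, *l))],
    where [omega (delta, *l)] is the sum of [delta_0 l_1 - delta_1 l_0] over the
    tetrahedra.  Here [omega] is the symplectic form of Neumann and Zagier on the
    decorations of abstract edges that agree on opposite edges and add up to
    zero at each vertex of a tetrahedron.

    Two orderings of a tetrahedron inducing the same pre-branching differ by a
    rotation of its four vertices.  A rotation of one step exchanges the labels
    0 and 1 and reverses the sign of the ordering, two changes that compensate
    each other in [delta_0 l_1 - delta_1 l_0] ([wedge_outgoing]); this gives the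
    first claim, once it is known that [*l] is the same for both orderings
    ([slogb_rewritten]).

    Both [delta] and [*l] also add up to zero around the edges of the
    triangulation.  The main point ([wedge_sum0]) is that [omega (x, y) = 0] for
    two such decorations as soon as [x] has zero weight along the normal loops
    of the boundary.  Such an [x] is a cocycle on the boundary without periods,
    hence it has a potential on the sides of the truncation triangles
    ([side_potential]).  A side is a corner of a face, and adding up the
    potential at the two ends of an edge in a face gives a function [e] of the
    edge alone, from which [x] is recovered by the formula for the logarithm of
    a cross-ratio ([edge_function]).  Then [omega (x, y)] is the sum over the
    edges of [e] times the sum of [y] around the edge, and vanishes.  Applied to
    the variations of [delta] and of [*l] when the boundary weights are kept,
    this shows that [omega (delta, *l)] depends on these weights only
    ([pairing_holonomy]); the signs are absorbed in a fourth root of unity.  The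
    second claim is the case in which all the weights are the same. *)

(** * Potentials on graphs *)

(** A graph is given by its oriented edges [D], the origin [src] and the reversal
    [inv]; [back x y] says that [y] goes back along the edge [x], which may hold
    for several [y] since [D] may list an oriented edge more than once. *)
Section Circulation.
Variables (D : finType) (V : eqType) (F : zmodType).
Variables (src : D -> V) (inv : D -> D) (kap : D -> F) (back : rel D).
Hypothesis invK : involutive inv.

Let step : rel D := fun x y => src (inv x) == src y.

Hypothesis back_irr : forall x, ~~ back x x.
Hypothesis back_tgt : forall x y, back x y -> src (inv y) = src x.
Hypothesis back_opp : forall x y, back x y -> kap y = - kap x.
Hypothesis reduced_cycle_sum : forall p, path.cycle step p ->
  uniq (map src p) -> {in p, forall x, ~~ back x (next p x)} ->
  \sum_(x <- p) kap x = 0.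

Lemma not_uniq_map_split (p : seq D) : ~~ uniq (map src p) ->
  exists a x b y c, src x = src y /\ p = a ++ x :: b ++ y :: c.
Proof.
elim: p => //= x q IH; rewrite negb_and negbK => /orP [/mapP [y yq exy]|/IH].
  by case/splitPr: yq => b c; exists [::], x, b, y, c.
by move=> [a [x' [b [y [c [e ->]]]]]]; exists (x :: a), x', b, y, c.
Qed.

Lemma cycle_split (x y : D) (b c : seq D) : src x = src y ->
  path.cycle step (x :: b ++ y :: c) ->
  path.cycle step (x :: b) /\ path.cycle step (y :: c).
Proof.
move=> exy; rewrite /= rcons_cat rcons_cons cat_path /= => /and3P [pb lb pc].
rewrite !rcons_path pb; split; first by move: lb; rewrite /step exy.
by move: pc; rewrite !rcons_path => /andP [-> ]; rewrite /step exy.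
Qed.

(** A closed walk that revisits a vertex splits there into two shorter closed
    walks, and a backtracking closed walk without repeated vertex has length
    two, so that its two contributions cancel. *)
Lemma closed_walk_sum (p : seq D) :
  path.cycle step p -> \sum_(x <- p) kap x = 0.
Proof.
have [n] := ubnP (size p); elim: n p => // n IH p /ltnSE le_pn cp.
have [up|/not_uniq_map_split] := boolP (uniq (map src p)); last first.
  move=> [a [x [b [y [c [exy def_p]]]]]].
  pose q := x :: b ++ y :: (c ++ a).
  have pq : perm_eq p q.
    by rewrite def_p perm_catC /q /= -!catA /= perm_refl.
  have sz := perm_size pq; rewrite (perm_big _ pq) /=.
  have: path.cycle step q.
    by move: cp; rewrite def_p cycle_catC /q /= -!catA.
  move=> /(cycle_split exy) [c1 c2].
  rewrite /q -cat_cons big_cat /= (IH (x :: b)) ?(IH (y :: c ++ a)) ?addr0 //.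
    by apply: leq_trans le_pn; rewrite sz /q /= !size_cat /= ?size_cat; lia.
  by apply: leq_trans le_pn; rewrite sz /q /= !size_cat /= ?size_cat; lia.
have [/allP nb|/allPn [x xp]] := boolP (all (fun x => ~~ back x (next p x)) p).
  exact: reduced_cycle_sum.
rewrite negbK => bx.
have [i q def_q] := rot_to xp.
have up' := map_uniq up.
move: bx; rewrite -(next_rot i up') def_q.
have uq : uniq (map src (x :: q)) by rewrite -def_q map_rot rot_uniq.
have cq : path.cycle step (x :: q) by rewrite -def_q rot_cycle.
have -> : \sum_(x <- p) kap x = \sum_(x <- x :: q) kap x.
  by apply: perm_big; rewrite -def_q perm_sym perm_rot.
case: q {def_q} uq cq => [|y q] uq cq; rewrite /= eqxx => bx.
  by rewrite (negPf (back_irr x)) in bx.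
case: q uq cq => [|z q] uq cq.
  by rewrite big_cons big_seq1 (back_opp bx) addrN.
move: cq => /= /and3P [_ /eqP eyz _]; move: uq.
by rewrite /= -eyz (back_tgt bx) !inE eqxx !orbT.
Qed.

Lemma step_connect_sym : connect_sym step.
Proof.
have back1 x y : step x y -> connect step y x.
  move=> /eqP exy; apply: (@connect_trans _ _ (inv y)).
    by apply: connect1; apply/eqP.
  apply: (@connect_trans _ _ (inv x)).
    by apply: connect1; apply/eqP; rewrite invK.
  by apply: connect1; apply/eqP; rewrite invK.
have half x y : connect step x y -> connect step y x.
  move=> /connectP [p]; elim: p x y => [|z p IH] x y /=; first by move=> _ ->.
  move=> /andP [sxz pz] ely.
  by apply: connect_trans (IH _ _ pz ely) (back1 _ _ sxz).
by move=> x y; apply/idP/idP; apply: half.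
Qed.

(** The potential at the end of [x] is the sum along any walk to [x] from a
    chosen root of its component. *)
Lemma circulation_potential : exists H : D -> F,
  (forall x y, src (inv x) = src y -> H y = H x + kap y) /\
  (forall x y, src (inv x) = src (inv y) -> H x = H y).
Proof.
pose r x := fingraph.root step x.
have walkP x : exists p, path step (r x) p && (last (r x) p == x).
  have: connect step (r x) x by rewrite step_connect_sym connect_root.
  by case/connectP=> p pp lp; exists p; rewrite pp -lp eqxx.
pose w x := xchoose (walkP x).
have wP x : path step (r x) (w x) /\ last (r x) (w x) = x.
  by have /andP [? /eqP] := xchooseP (walkP x).
pose H x := \sum_(z <- w x) kap z.
have Hstep x y : src (inv x) = src y -> H y = H x + kap y.
  move=> exy; have sxy : step x y by apply/eqP.
  have rxy : r x = r y by apply/(fingraph.rootP step_connect_sym)/connect1.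
  have : connect step y (r x) by rewrite rxy connect_root.
  case/connectP=> q pq lq; have [px lx] := wP x; have [py ly] := wP y.
  have closed p : path step (r x) p -> last (r x) p = r x -> \sum_(z <- p) kap z = 0.
    move=> pp lp; apply: closed_walk_sum.
    case/lastP: p pp lp => [|p z pp] //.
    rewrite last_rcons => ez; rewrite -ez in pp.
    by rewrite -rot1_cons rot_cycle.
  have c1 : \sum_(z <- w x ++ y :: q) kap z = 0.
    by apply: closed; rewrite ?cat_path ?last_cat //= px lx sxy.
  have c2 : \sum_(z <- w y ++ q) kap z = 0.
    by apply: closed; rewrite ?cat_path ?last_cat rxy ly ?py // -rxy.
  move: c1 c2; rewrite !big_cat big_cons /= -/(H x) -/(H y) addrA => c1 c2.
  by apply: (addIr (\sum_(j <- q) kap j)); rewrite c1 c2.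
exists H; split=> // x y exy.
by apply: (addIr (kap (inv x))); rewrite -!Hstep.
Qed.

End Circulation.

(** * Permutations of the vertices of a tetrahedron *)

Local Notation t01 := (tperm (0 : 'I_4) (1 : 'I_4)).
Local Notation t12 := (tperm (1 : 'I_4) (2 : 'I_4)).
Local Notation t23 := (tperm (2 : 'I_4) (3 : 'I_4)).

Lemma ord4P (i : 'I_4) : [\/ i = 0, i = 1, i = 2 | i = 3].
Proof.
case: i => [[|[|[|[|//]]]] i4].
- by apply: Or41; apply: val_inj.
- by apply: Or42; apply: val_inj.
- by apply: Or43; apply: val_inj.
- by apply: Or44; apply: val_inj.
Qed.

Lemma perm4_surj (s : 'S_4) i : [\/ i = s 0, i = s 1, i = s 2 | i = s 3].
Proof.
by rewrite -(permKV s i); case: (ord4P ((s^-1)%g i)) => ->;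
  [apply: Or41 | apply: Or42 | apply: Or43 | apply: Or44].
Qed.

Lemma perm4_eq (s t : 'S_4) :
  s 0 = t 0 -> s 1 = t 1 -> s 2 = t 2 -> s 3 = t 3 -> s = t.
Proof. by move=> e0 e1 e2 e3; apply/permP=> i; case: (ord4P i) => ->. Qed.

Lemma perm4_neq (s : 'S_4) :
  ((s 0 == s 1) = false) * ((s 0 == s 2) = false) * ((s 0 == s 3) = false) *
  ((s 1 == s 0) = false) * ((s 1 == s 2) = false) * ((s 1 == s 3) = false) *
  ((s 2 == s 0) = false) * ((s 2 == s 1) = false) * ((s 2 == s 3) = false) *
  ((s 3 == s 0) = false) * ((s 3 == s 1) = false) * ((s 3 == s 2) = false).
Proof. by rewrite !(inj_eq perm_inj). Qed.

Lemma swap01E (s : 'S_4) : ((t01 * s)%g 0 = s 1) * ((t01 * s)%g 1 = s 0)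
  * ((t01 * s)%g 2 = s 2) * ((t01 * s)%g 3 = s 3).
Proof. by rewrite !permM ?tpermL ?tpermR !tpermD. Qed.

Lemma swap12E (s : 'S_4) : ((t12 * s)%g 0 = s 0) * ((t12 * s)%g 1 = s 2)
  * ((t12 * s)%g 2 = s 1) * ((t12 * s)%g 3 = s 3).
Proof. by rewrite !permM ?tpermL ?tpermR !tpermD. Qed.

Lemma swap23E (s : 'S_4) : ((t23 * s)%g 0 = s 0) * ((t23 * s)%g 1 = s 1)
  * ((t23 * s)%g 2 = s 3) * ((t23 * s)%g 3 = s 2).
Proof. by rewrite !permM ?tpermL ?tpermR !tpermD. Qed.

Lemma perm4_fix03 (s t : 'S_4) : t 0 = s 0 -> t 3 = s 3 ->
  t = s \/ t = (t12 * s)%g.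
Proof.
move=> e0 e3.
have [e|e|e|e] := perm4_surj s (t 1).
- by move/eqP: e; rewrite -e0 perm4_neq.
- have [f|f|f|f] := perm4_surj s (t 2).
  + by move/eqP: f; rewrite -e0 perm4_neq.
  + by move/eqP: f; rewrite -e perm4_neq.
  + by left; apply: perm4_eq.
  + by move/eqP: f; rewrite -e3 perm4_neq.
- have [f|f|f|f] := perm4_surj s (t 2).
  + by move/eqP: f; rewrite -e0 perm4_neq.
  + by right; apply: perm4_eq; rewrite swap12E.
  + by move/eqP: f; rewrite -e perm4_neq.
  + by move/eqP: f; rewrite -e3 perm4_neq.
- by move/eqP: e; rewrite -e3 perm4_neq.
Qed.

Lemma perm4_fix01 (s t : 'S_4) : t 0 = s 0 -> t 1 = s 1 ->
  t = s \/ t = (t23 * s)%g.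
Proof.
move=> e0 e1.
have [e|e|e|e] := perm4_surj s (t 2).
- by move/eqP: e; rewrite -e0 perm4_neq.
- by move/eqP: e; rewrite -e1 perm4_neq.
- have [f|f|f|f] := perm4_surj s (t 3).
  + by move/eqP: f; rewrite -e0 perm4_neq.
  + by move/eqP: f; rewrite -e1 perm4_neq.
  + by move/eqP: f; rewrite -e perm4_neq.
  + by left; apply: perm4_eq.
- have [f|f|f|f] := perm4_surj s (t 3).
  + by move/eqP: f; rewrite -e0 perm4_neq.
  + by move/eqP: f; rewrite -e1 perm4_neq.
  + by right; apply: perm4_eq; rewrite swap23E.
  + by move/eqP: f; rewrite -e perm4_neq.
Qed.

Lemma perm4_edge (A : {set 'I_4}) : #|A| = 2%N ->
  exists s : 'S_4, A = [set s 0; s 1].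
Proof.
move/eqP/cards2P => [u [v [uv ->]]].
have w0 : tperm 0 u v != 0.
  by apply: contraNneq uv => /(canRL (tpermK 0 u)); rewrite tpermL => ->.
exists (tperm 1%R (tperm 0%R u v) * tperm 0%R u)%g.
by rewrite !permM [tperm _ _ 1]tpermL [tperm 1 _ 0]tpermD // tpermL tpermK.
Qed.

Lemma card_edge (s : 'S_4) : #|[set s 0; s 1]| = 2%N.
Proof. by rewrite cards2 perm4_neq. Qed.

Lemma bsign_swap (s : 'S_4) (i j : 'I_4) : i != j -> bsign (tperm i j * s) = - bsign s.
Proof. by move=> ij; rewrite /bsign odd_permM odd_tperm ij; case: odd_perm. Qed.

(** * Potential of a cocycle on the boundary *)

Section Flags.
Variable T : gluing.

(** A pair [(d, s)] stands for the side on face [s 3] of the truncation triangle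
    at vertex [s 0].  The order of [s 1] and [s 2] is redundant, but in this form
    going through the face is a composition of permutations, and the parity of
    [s] changes in crossing. *)
Definition cross (a : Defs.arc T) : Defs.arc T :=
  (nbr a.1 (a.2 3), (a.2 * glue a.1 (a.2 3))%g).

Definition pre (t : 'S_4) (a : Defs.arc T) : Defs.arc T := (a.1, (t * a.2)%g).

Lemma crossK : involutive cross.
Proof.
case=> d s; rewrite /cross /= !permM nbrK glueK.
by rewrite mulgK.
Qed.

Lemma cross_pre (t : 'S_4) a : t 3 = 3 -> cross (pre t a) = pre t (cross a).
Proof. by move=> t3; rewrite /cross /pre /= !permM t3 mulgA. Qed.

Lemma cross_next (a a' : Defs.arc T) : arc_tri a' = arc_tri (cross a) ->
  a'.2 2 = (cross a).2 3 -> next_arc a a'.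
Proof.
by case: a a' => [d s] [d' s'] [-> e0] e2; rewrite /next_arc /= e0 e2 !permM !eqxx.
Qed.

Section Potential.
Variables (F : numFieldType) (X : tet T -> {set 'I_4} -> F).
Hypothesis X_sum : forall d (s : 'S_4),
  X d [set s 0; s 1] + X d [set s 0; s 2] + X d [set s 0; s 3] = 0.
Hypothesis X_loop : forall C : seq (Defs.arc T), normal_loop C ->
  \sum_(a <- C) (bsign a.2)%:~R * X a.1 (arc_edge a) = 0.

(** Within one triangle the arcs have a potential on the sides because the
    three values at the vertices add up to zero; this is the one of zero mean. *)
Let psi (a : Defs.arc T) : F := (bsign a.2)%:~R *
  (X a.1 [set a.2 0; a.2 1] - X a.1 [set a.2 0; a.2 2]) / 3.

Lemma psi_pre12 a : psi (pre t12 a) = psi a.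
Proof. by rewrite /psi /= !swap12E bsign_swap // rmorphN /=; ring. Qed.

Lemma psi_pre23 a :
  psi a - psi (pre t23 a) = (bsign a.2)%:~R * X a.1 (arc_edge a).
Proof.
have e := X_sum a.1 a.2; rewrite /psi /arc_edge /= !swap23E bsign_swap // rmorphN /=.
set x := X _ _ in e *; set y := X _ _ in e *; set z := X _ _ in e *.
have -> : z = - x - y by apply/eqP; rewrite -subr_eq0 -e; apply/eqP; ring.
by field.
Qed.

Lemma psi_side a a' : arc_tri a = arc_tri a' -> a.2 3 = a'.2 3 -> psi a = psi a'.
Proof.
case: a a' => [d s] [d' s'] /= [-> e0] e3.
by case: (perm4_fix03 (esym e0) (esym e3)) => -> //; rewrite -(psi_pre12 (d', s)).
Qed.

Let back (x y : Defs.arc T) : bool :=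
  (arc_tri y == arc_tri (cross x)) && (y.2 3 == (cross x).2 3).

Let kap (x : Defs.arc T) : F := psi x - psi (cross x).

Lemma cross_side x y : arc_tri x = arc_tri y -> x.2 3 = y.2 3 ->
  arc_tri (cross x) = arc_tri (cross y) /\ (cross x).2 3 = (cross y).2 3.
Proof.
by case: x y => [d s] [d' s'] /= [-> e0] e3; rewrite /arc_tri /= !permM e0 e3.
Qed.

(** In a loop without backtracking, the side by which a triangle is entered and
    the side by which it is left determine a normal arc; the value of this arc is
    the difference of [psi] between them. *)
Lemma reduced_loop_sum p :
  path.cycle (fun x y => arc_tri (cross x) == arc_tri y) p ->
  uniq (map (@arc_tri T) p) -> {in p, forall x, ~~ back x (next p x)} ->
  \sum_(x <- p) kap x = 0.
Proof.
move=> cp up nb; have up' := map_uniq up.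
(* The arc of the triangle of [y] entered from [x]: it turns around [y.2 1] or
   around [y.2 2], and the latter case exchanges these two vertices. *)
pose bend (x y : Defs.arc T) : Defs.arc T := if y.2 2 == (cross x).2 3 then y else pre t12 y.
have bend_tri x y : arc_tri (bend x y) = arc_tri y.
  by rewrite /bend; case: ifP => //; rewrite /arc_tri /= swap12E.
have bend3 x y : (bend x y).2 3 = y.2 3.
  by rewrite /bend; case: ifP => //=; rewrite swap12E.
have bend2 x y : arc_tri (cross x) = arc_tri y -> ~~ back x y ->
    (bend x y).2 2 = (cross x).2 3.
  move=> exy nxy; rewrite /bend; case: eqP => //= n2; rewrite swap12E.
  have [e|e|e|e] := perm4_surj y.2 ((cross x).2 3) => //.
  - have : (cross x).2 0 = y.2 0 by case: exy.
    by rewrite -e => /eqP; rewrite perm4_neq.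
  - by case: n2.
  - by move: nxy; rewrite /back exy e !eqxx.
pose f x := bend (prev p x) x.
have nP x : x \in p -> arc_tri (cross (prev p x)) = arc_tri x /\ ~~ back (prev p x) x.
  move=> xp; split; first by apply/eqP; exact: (prev_cycle cp).
  by have := nb (prev p x); rewrite mem_prev next_prev //; apply.
have loop : normal_loop (map f p).
  rewrite /normal_loop -map_comp (eq_map (g := @arc_tri T)) ?up ?andbT; last first.
    by move=> x /=; rewrite bend_tri.
  rewrite cycle_map; apply: cycle_from_next => // x xp /=.
  have np : next p x \in p by rewrite mem_next.
  have [e nbx] := nP _ np; rewrite prev_next // in e nbx.
  have [e1 e3] := cross_side (bend_tri (prev p x) x) (bend3 (prev p x) x).
  apply: cross_next; rewrite /f prev_next // ?bend_tri ?e1 //.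
  by rewrite e3 bend2.
have := X_loop loop; rewrite big_map => loop0; rewrite -[RHS]loop0.
transitivity (\sum_(x <- p) (psi x - psi (cross (prev p x)))).
  rewrite /kap !big_split /= !sumrN; congr (_ - _).
  rewrite -(big_map (prev p) predT (fun x => psi (cross x))).
  apply: perm_big; apply: uniq_perm => //.
    by rewrite map_inj_uniq //; apply: can_inj (next_prev up').
  move=> x; apply/idP/mapP => [xp|[y yp ->]]; last by rewrite mem_prev.
  by exists (next p x); rewrite ?mem_next ?prev_next.
apply: eq_big_seq => x xp.
have [e nbx] := nP _ xp.
rewrite -psi_pre23; congr (_ - _).
  by apply: psi_side; rewrite ?bend_tri ?bend3.
apply: psi_side; first by rewrite e -(bend_tri (prev p x)) /arc_tri /= swap23E.
by rewrite /= swap23E /f bend2.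
Qed.

(** The jumps [kap] of [psi] across the sides form a circulation on the dual graph
    of the boundary; adding to [psi] in each triangle the value there of a potential
    of this circulation makes it single-valued on the sides. *)
Lemma side_potential : exists phi : Defs.arc T -> F,
  [/\ forall a, phi (cross a) = phi a, forall a, phi (pre t12 a) = phi a &
      forall a, phi a - phi (pre t23 a) = (bsign a.2)%:~R * X a.1 (arc_edge a)].
Proof.
have [||||H [Hstep Htgt]] := @circulation_potential _ _ _ (@arc_tri T) cross kap back crossK.
- move=> x; apply: contra (glue_neq x.1 (x.2 3)) => /andP [/eqP [e _] /eqP].
  by rewrite /= permM -e => <-.
- move=> x y /andP [/eqP e1 /eqP e2].
  by have [-> _] := cross_side e1 e2; rewrite crossK.
- move=> x y /andP [/eqP e1 /eqP e2].
  have [f1 f2] := cross_side e1 e2; rewrite crossK in f1 f2.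
  by rewrite /kap (psi_side e1 e2) (psi_side f1 f2) opprB.
- exact: reduced_loop_sum.
pose phi a := psi a + H (cross a).
have tri_pre (t : 'S_4) a : t 0 = 0 -> H (cross (pre t a)) = H (cross a).
  by move=> t0; apply: Htgt; rewrite !crossK /arc_tri /= permM t0.
exists phi; split=> a.
- rewrite /phi crossK (Hstep (cross a) a) ?crossK // /kap; ring.
- by rewrite /phi psi_pre12 tri_pre // tpermD.
- by rewrite /phi -psi_pre23 tri_pre ?tpermD //; ring.
Qed.

End Potential.
End Flags.

(** * The symplectic form on decorations of the edges *)

Lemma edge_adj_sym (T : gluing) : symmetric (@edge_adj T).
Proof.
suff half x y : @edge_adj T x y -> edge_adj y x by move=> x y; apply/idP/idP; apply: half.
case: x => d A /existsP [i /andP [iA /eqP ->]] /=; apply/existsP.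
exists (glue d i i); rewrite /= nbrK glueK mem_imset ?iA /=; last exact: perm_inj.
by rewrite -imset_comp (eq_imset (g := id)) ?imset_id // => v; rewrite /= permK.
Qed.

Lemma edge_adj_card (T : gluing) (x y : aedge T) : edge_adj x y -> #|x.2| = #|y.2|.
Proof.
by move=> /existsP [i /andP [_ /eqP ->]]; rewrite card_imset //; apply: perm_inj.
Qed.

Section SymplecticForm.
Variables (T : gluing) (F : numFieldType).
Implicit Types (X Y : tet T -> {set 'I_4} -> F) (b : tet T -> 'S_4).

Definition opposite_eq X := forall d (s : 'S_4), X d [set s 0; s 1] = X d [set s 2; s 3].

Definition vertex_sum0 X := forall d (s : 'S_4),
  X d [set s 0; s 1] + X d [set s 0; s 2] + X d [set s 0; s 3] = 0.

Definition edge_sum0 X := forall x : aedge T, #|x.2| = 2%N ->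
  \sum_(y | around x y) X y.1 y.2 = 0.

Definition loop_sum0 X := forall C : seq (Defs.arc T), normal_loop C ->
  \sum_(a <- C) (bsign a.2)%:~R * X a.1 (arc_edge a) = 0.

(** The contribution of a tetrahedron to the symplectic form; the sign of [s]
    corrects for the cyclic order of the three pairs of opposite edges. *)
Definition wedge (s : 'S_4) (x y : {set 'I_4} -> F) : F :=
  (bsign s)%:~R * (x [set s 0; s 1] * y [set s 1; s 2]
                   - x [set s 1; s 2] * y [set s 0; s 1]).

Lemma edge_function_pairing (e : tet T -> {set 'I_4} -> F) Y :
  (forall x y : aedge T, #|x.2| = 2%N -> edge_adj x y -> e x.1 x.2 = e y.1 y.2) ->
  edge_sum0 Y -> \sum_(z : aedge T | #|z.2| == 2%N) e z.1 z.2 * Y z.1 z.2 = 0.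
Proof.
move=> e_adj Y0; have sym := sym_connect_sym (@edge_adj_sym T).
have e_conn (x y : aedge T) : #|x.2| = 2%N -> connect (@edge_adj T) x y ->
    #|y.2| = 2%N /\ e x.1 x.2 = e y.1 y.2.
  move=> x2 /connectP [p]; elim: p x x2 => [|z p IH] x x2 /=; first by move=> _ ->.
  move=> /andP [xz pz] ly; rewrite (e_adj _ _ x2 xz); apply: IH pz ly.
  by rewrite -(edge_adj_card xz).
rewrite (partition_big (fingraph.root (@edge_adj T)) xpredT) //=.
apply: big1 => r _.
have [x /andP [/eqP x2 /eqP rx]|none] :=
  pickP (fun z : aedge T => (#|z.2| == 2%N) && (fingraph.root (@edge_adj T) z == r)); last first.
  by rewrite big_pred0.
have aE (z : aedge T) :
    (#|z.2| == 2%N) && (fingraph.root (@edge_adj T) z == r) = around x z.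
  rewrite -rx eq_sym (root_connect sym) [connect _ _ _]sym /around.
  apply/idP/idP => [/andP [] //|xz].
  by rewrite xz; have [-> _] := e_conn _ _ x2 xz.
rewrite (eq_bigl _ _ aE) (eq_bigr (fun z => e x.1 x.2 * Y z.1 z.2)) => [|z xz].
  by rewrite -mulr_sumr Y0 // mulr0.
by have [_ ->] := e_conn _ _ x2 xz.
Qed.

(** The six edges are distinguished by the vertices among [s 0], [s 1], [s 2]
    that they contain. *)
Lemma sum_edges (s : 'S_4) (g : {set 'I_4} -> F) :
  \sum_(A : {set 'I_4} | #|A| == 2%N) g A =
    g [set s 0; s 1] + g [set s 2; s 3] + g [set s 1; s 2] + g [set s 0; s 3]
    + g [set s 0; s 2] + g [set s 1; s 3].
Proof.
pose r : seq {set 'I_4} := [:: [set s 0; s 1]; [set s 2; s 3]; [set s 1; s 2];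
   [set s 0; s 3]; [set s 0; s 2]; [set s 1; s 3]].
rewrite -big_filter (perm_big r) /=; first by rewrite !big_cons big_nil !addrA addr0.
apply: uniq_perm.
- by rewrite filter_uniq // index_enum_uniq.
- apply: (@map_uniq _ _ (fun A : {set 'I_4} => (s 0 \in A, s 1 \in A, s 2 \in A))).
  by rewrite /= !inE !eqxx !perm4_neq.
move=> A; rewrite mem_filter mem_index_enum andbT.
apply/idP/idP => [/eqP /perm4_edge [t ->]|].
  have := perm4_neq t; rewrite !inE.
  case: (perm4_surj s (t 0)) => e0; case: (perm4_surj s (t 1)) => e1 tn;
    try (by move: tn; rewrite e0 e1 !eqxx; do ![case]);
    by rewrite e0 e1 ?eqxx ?orbT // (setUC [set _]) eqxx ?orbT.
by rewrite !inE => /or4P[|||/or3P []] /eqP ->; rewrite cards2 perm4_neq.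
Qed.

(** The values of the potential at the two ends of an edge in a face add up to
    the same number in both faces of a tetrahedron containing the edge, because
    the two differences come from the arcs around the edge at its two ends and
    have opposite signs.  Halving this sum gives a function on edges, and
    recovering the potential from it gives the formula. *)
Lemma edge_function X : vertex_sum0 X -> loop_sum0 X ->
  exists e : tet T -> {set 'I_4} -> F,
    (forall x y : aedge T, #|x.2| = 2%N -> edge_adj x y -> e x.1 x.2 = e y.1 y.2) /\
    (forall d (s : 'S_4), (bsign s)%:~R * X d [set s 0; s 1] =
       e d [set s 1; s 2] + e d [set s 0; s 3] - e d [set s 0; s 2] - e d [set s 1; s 3]).
Proof.
move=> Xv Xl; have [phi [phi_cross phi12 phi23]] := side_potential Xv Xl.
(* Minus half the sum of the potential at the ends [s 0], [s 1] in the face [s 3]. *)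
pose eps (a : Defs.arc T) : F := - (phi a + phi (pre t01 a)) / 2.
have preK t (a : Defs.arc T) : pre (tperm t.1 t.2) (pre (tperm t.1 t.2) a) = a.
  by case: a => d s; rewrite /pre /= mulgA tperm2 mul1g.
have eps01 a : eps (pre t01 a) = eps a.
  by rewrite /eps (preK (0, 1)) addrC.
have comm (a : Defs.arc T) : pre t01 (pre t23 a) = pre t23 (pre t01 a).
  by congr (_, _); apply: perm4_eq; rewrite !(swap01E, swap23E).
have phi23' a : phi (pre t01 a) - phi (pre t23 (pre t01 a)) = - (phi a - phi (pre t23 a)).
  rewrite !phi23 /arc_edge /= !swap01E bsign_swap // rmorphN mulNr.
  by rewrite [in LHS]setUC.
have eps23 a : eps (pre t23 a) = eps a.
  rewrite /eps comm; congr (- _ / 2); apply/eqP.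
  rewrite eq_sym -subr_eq0 opprD addrACA phi23'.
  by apply/eqP; ring.
have eps_cross a : eps (cross a) = eps a.
  by rewrite /eps -cross_pre ?tpermD // !phi_cross.
have eps_set d (s t : 'S_4) : [set t 0; t 1] = [set s 0; s 1] -> eps (d, t) = eps (d, s).
  move=> st; have t0 : t 0 \in [set s 0; s 1] by rewrite -st !inE eqxx.
  have t1 : t 1 \in [set s 0; s 1] by rewrite -st !inE eqxx orbT.
  move: t0 t1; rewrite !inE => /orP [] /eqP e0 /orP [] /eqP e1;
    try by have := perm4_neq t; rewrite e0 e1 eqxx; do ![case].
    by case: (perm4_fix01 e0 e1) => -> //; rewrite -(eps23 (d, s)).
  rewrite -(eps01 (d, s)).
  have := @perm4_fix01 (t01 * s)%g t; rewrite !swap01E => /(_ e0 e1) [] -> //.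
  by rewrite -(eps23 (pre t01 (d, s))).
pose e d A := if [pick s : 'S_4 | [set s 0; s 1] == A] is Some s then eps (d, s) else 0.
have eE d (s : 'S_4) : e d [set s 0; s 1] = eps (d, s).
  by rewrite /e; case: pickP => [t /eqP /eps_set ->|/(_ s)] //; rewrite eqxx.
exists e; split=> [[d A] y /= A2|d s].
  have [s ->] := perm4_edge A2 => /existsP [i /andP [iA /eqP ->]] /=.
  have step (t : 'S_4) : [set t 0; t 1] = [set s 0; s 1] -> i = t 3 ->
      e d [set s 0; s 1] = e (nbr d i) [set glue d i v | v in [set s 0; s 1]].
    move=> <- ->; rewrite imsetU !imset_set1 -!permM !eE.
    by rewrite -(eps_cross (d, t)).
  move: iA; rewrite !inE negb_or => /andP [i0 i1].
  have [e0|e0|e0|e0] := perm4_surj s i.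
  - by rewrite e0 eqxx in i0.
  - by rewrite e0 eqxx in i1.
  - by apply: (step (t23 * s)%g); rewrite ?swap23E.
  - exact: (step s).
(* The edges [s 0, s 2] and [s 1, s 2] are taken in the face [s 3], and below
   [s 0, s 3] and [s 1, s 3] in the face [s 2], so that the terms at [s 2] and at
   [s 3] cancel. *)
have phi_side (a c : Defs.arc T) : a.1 = c.1 -> a.2 0 = c.2 0 -> a.2 3 = c.2 3 ->
    phi a = phi c.
  case: a c => [d1 s1] [d2 s2] /= -> e0 e3.
  by case: (perm4_fix03 (esym e0) (esym e3)) => -> //; rewrite -(phi12 (d2, s1)).
have e02 (t : 'S_4) : e d [set t 0; t 2] = - (phi (d, t) + phi (pre t01 (pre t12 (d, t)))) / 2.
  have := eE d (t12 * t)%g; rewrite !swap12E => ->.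
  by rewrite /eps (phi12 (d, t)).
have e12 (t : 'S_4) : e d [set t 1; t 2] =
    - (phi (pre t01 (d, t)) + phi (pre t01 (pre t12 (d, t)))) / 2.
  have := e02 (t01 * t)%g; rewrite !swap01E => ->.
  congr (- (_ + _) / 2); apply: phi_side => //=; by rewrite !(swap01E, swap12E).
have e03 := e02 (t23 * s)%g; have e13 := e12 (t23 * s)%g.
rewrite !swap23E in e03 e13.
rewrite e02 e12 e03 e13 -[LHS](phi23 (d, s)).
have f := phi23' (d, s); rewrite -comm in f.
rewrite -/(pre t23 (d, s)).
set p1 := phi (d, s) in f *; set p2 := phi (pre t23 (d, s)) in f *.
set p3 := phi (pre t01 (d, s)) in f *; set p4 := phi (pre t01 (pre t23 (d, s))) in f *.
have -> : p4 = p3 + p1 - p2.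
  by rewrite -[p4](subKr p3) f; ring.
by field.
Qed.

(** A decoration without boundary holonomy is the coboundary of an edge
    function, and the form pairs coboundaries with decorations by summing the
    latter around edges. *)
Lemma wedge_sum0 b X Y : vertex_sum0 X -> loop_sum0 X ->
  opposite_eq Y -> vertex_sum0 Y -> edge_sum0 Y ->
  \sum_d wedge (b d) (X d) (Y d) = 0.
Proof.
move=> Xv Xl Yo Yv Ye; have [e [e_adj eX]] := edge_function Xv Xl.
rewrite -[RHS](edge_function_pairing e_adj Ye).
rewrite -(pair_big xpredT (fun A : {set 'I_4} => #|A| == 2%N) (fun d A => e d A * Y d A)) /=.
apply: eq_bigr => d _; rewrite (sum_edges (b d)) /wedge; set s := b d.
have x0 := eX d s.
(* [r] is the cyclic rotation of the first three vertices, an even permutation. *)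
pose r := (t12 * (t01 * s))%g.
have rE : ((r 0 = s 1) * (r 1 = s 2) * (r 2 = s 0) * (r 3 = s 3))%type.
  by rewrite !(swap12E, swap01E).
have := eX d r; rewrite !rE !bsign_swap // opprK (setUC [set s 2] [set s 0]).
rewrite (setUC [set s 1] [set s 0]) => x1.
have y0 : Y d [set s 2; s 3] = Y d [set s 0; s 1] by rewrite Yo.
have y1 : Y d [set s 0; s 3] = Y d [set s 1; s 2] 
  by have := Yo d r; rewrite !rE (setUC [set s 0]) => ->; rewrite setUC.
have y2 : Y d [set s 1; s 3] = Y d [set s 0; s 2].
  by have := Yo d (t12 * s)%g; rewrite !swap12E => ->.
have y12 : Y d [set s 1; s 2] = - Y d [set s 0; s 1] - Y d [set s 0; s 2].
  by apply/eqP; rewrite -subr_eq0 -(Yv d s) y1; apply/eqP; ring.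
rewrite mulrBr !mulrA x0 x1 y0 y1 y2 y12; ring.
Qed.

End SymplecticForm.

(** * Branchings and rotations *)

Lemma edge_labelE (s : 'S_4) :
  ((edge_label s [set s 0; s 1] = 0) * (edge_label s [set s 1; s 0] = 0) *
  (edge_label s [set s 2; s 3] = 0) * (edge_label s [set s 3; s 2] = 0) *
  (edge_label s [set s 1; s 2] = 1) * (edge_label s [set s 2; s 1] = 1) *
  (edge_label s [set s 0; s 3] = 1) * (edge_label s [set s 3; s 0] = 1) *
  (edge_label s [set s 0; s 2] = 2) * (edge_label s [set s 2; s 0] = 2) *
  (edge_label s [set s 1; s 3] = 2) * (edge_label s [set s 3; s 1] = 2))%type.
Proof.
have lab i j : i != j -> edge_label s [set s i; s j] =
    if (i + j == 1)%N || (i + j == 5)%N then 0 else if (i + j == 3)%N then 1 else 2.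
  by move=> ij; rewrite /edge_label big_setU1 ?big_set1 ?inE ?(inj_eq perm_inj) //= !permK.
by rewrite !lab.
Qed.

Lemma perm4_rank_ind (s t : 'S_4) (P : 'I_4 -> 'I_4 -> 'I_4 -> 'I_4 -> Prop) :
  (forall i j k l, uniq [:: i; j; k; l] -> P (s i) (s j) (s k) (s l)) ->
  P (t 0) (t 1) (t 2) (t 3).
Proof.
move=> Ps; have rank k : t k = s ((t * s^-1)%g k) by rewrite permM permKV.
by rewrite !rank; apply: Ps; rewrite /= !inE !(inj_eq perm_inj).
Qed.

Lemma on_edge_opposite (T : gluing) (F : numFieldType) b (u : tet T -> 'I_3 -> F) :
  opposite_eq (on_edge b u).
Proof.
move=> d t; rewrite /on_edge; congr (u d _).
apply: (@perm4_rank_ind (b d) t (fun i j k l =>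
  edge_label _ [set i; j] = edge_label _ [set k; l])) => i j k l.
by case: (ord4P i) => ->; case: (ord4P j) => -> //; case: (ord4P k) => -> //;
  case: (ord4P l) => -> // _; rewrite !edge_labelE.
Qed.

Lemma on_edge_vertex_sum0 (T : gluing) (F : numFieldType) b (u : tet T -> 'I_3 -> F) :
  (forall d, u d 0 + u d 1 + u d 2 = 0) -> vertex_sum0 (on_edge b u).
Proof.
move=> u0 d t; rewrite /on_edge -[RHS](u0 d).
apply: (@perm4_rank_ind (b d) t (fun i j k l => u d (edge_label _ [set i; j])
  + u d (edge_label _ [set i; k]) + u d (edge_label _ [set i; l]) = _)) => i j k l.
by case: (ord4P i) => ->; case: (ord4P j) => -> //; case: (ord4P k) => -> //;
  case: (ord4P l) => -> // _; rewrite !edge_labelE; ring.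
Qed.

Lemma wedge_on_edge (T : gluing) (F : numFieldType) b (u v : tet T -> 'I_3 -> F) d :
  wedge (b d) (on_edge b u d) (on_edge b v d) =
    (bsign (b d))%:~R * (u d 0 * v d 1 - u d 1 * v d 0).
Proof. by rewrite /wedge /on_edge !edge_labelE. Qed.

Section Rotation.
Variable F : numFieldType.
Variables x y : {set 'I_4} -> F.
Hypothesis x_opp : forall s : 'S_4, x [set s 0; s 1] = x [set s 2; s 3].
Hypothesis y_opp : forall s : 'S_4, y [set s 0; s 1] = y [set s 2; s 3].

Definition rotate (s : 'S_4) : 'S_4 := (t01 * (t12 * (t23 * s)))%g.

Lemma rotateE (s : 'S_4) : ((rotate s 0 = s 3) * (rotate s 1 = s 0) * (rotate s 2 = s 1)
  * (rotate s 3 = s 2))%type.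
Proof. by rewrite /rotate !(swap01E, swap12E, swap23E). Qed.

Lemma wedge_rotate s : wedge (rotate s) x y = wedge s x y.
Proof.
rewrite /wedge !rotateE /rotate !bsign_swap // opprK.
have opp (z : {set 'I_4} -> F) : (forall s : 'S_4, z [set s 0; s 1] = z [set s 2; s 3]) ->
   z [set s 3; s 0] = z [set s 1; s 2].
  by move=> z_opp; have := z_opp (rotate s); rewrite !rotateE.
by rewrite !opp // rmorphN; ring.
Qed.

Lemma outgoing_at (s : 'S_4) j : outgoing s (s j) = ~~ odd j (+) odd_perm s.
Proof. by rewrite /outgoing permK. Qed.

Lemma outgoing_rotate s i : outgoing (rotate s) i = outgoing s i.
Proof.
have odd_rotate : odd_perm (rotate s) = ~~ odd_perm s.
  by rewrite /rotate !odd_permM !odd_tperm /=; case: odd_perm.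
have [->|->|->|->] := perm4_surj s i; rewrite outgoing_at.
- by rewrite -(rotateE s).1.1.2 outgoing_at odd_rotate; case: odd_perm.
- by rewrite -(rotateE s).1.2 outgoing_at odd_rotate; case: odd_perm.
- by rewrite -(rotateE s).2 outgoing_at odd_rotate; case: odd_perm.
- by rewrite -(rotateE s).1.1.1 outgoing_at odd_rotate; case: odd_perm.
Qed.

(** The rank of a vertex has the parity prescribed by the pre-branching and the
    sign; fixing the first vertex fixes the sign, hence also the third vertex,
    and the sign then decides the order of the other two. *)
Lemma outgoing_inj0 (s t : 'S_4) : (forall i, outgoing t i = outgoing s i) ->
  t 0 = s 0 -> t = s.
Proof.
move=> st e0; have := st (t 0); rewrite {2}e0 !outgoing_at => /addbI odd_st.
have := st (t 2); rewrite outgoing_at odd_st.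
have [e|e|e|e] := perm4_surj s (t 2); rewrite e outgoing_at.
- by move/eqP: e; rewrite -e0 perm4_neq.
- by move/addIb.
- move=> _; have [f|f|f|f] := perm4_surj s (t 1).
  + by move/eqP: f; rewrite -e0 perm4_neq.
  + by case: (perm4_fix01 e0 f) => // et; move: odd_st; rewrite et odd_permM odd_tperm;
      case: odd_perm.
  + by move/eqP: f; rewrite -e perm4_neq.
  + have et : t = (tperm 1%R 3%R * s)%g.
      apply/permP=> i; rewrite permM; case: (ord4P i) => ->; rewrite ?e0 ?f ?e.
      * by rewrite tpermD.
      * by rewrite tpermL.
      * by rewrite tpermD.
      have [g|g|g|g] := perm4_surj s (t 3).
      * by move/eqP: g; rewrite -e0 perm4_neq.
      * by rewrite g tpermR.
      * by move/eqP: g; rewrite -e perm4_neq.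
      * by move/eqP: g; rewrite -f perm4_neq.
    by move: odd_st; rewrite et odd_permM odd_tperm; case: odd_perm.
- by move/addIb.
Qed.

(** The orderings inducing a given pre-branching of a tetrahedron are the four
    rotations of one of them; a rotation exchanges the labels 0 and 1 and
    reverses the sign of the ordering. *)
Lemma wedge_outgoing (s t : 'S_4) : (forall i, outgoing t i = outgoing s i) ->
  wedge t x y = wedge s x y.
Proof.
move=> st.
have [e|e|e|e] := perm4_surj s (t 0).
- by rewrite (outgoing_inj0 st e).
- rewrite (@outgoing_inj0 (rotate (rotate (rotate s))) t) ?wedge_rotate ?rotateE //.
  by move=> i; rewrite !outgoing_rotate.
- rewrite (@outgoing_inj0 (rotate (rotate s)) t) ?wedge_rotate ?rotateE //.
  by move=> i; rewrite !outgoing_rotate.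
rewrite (@outgoing_inj0 (rotate s) t) ?wedge_rotate ?rotateE //.
by move=> i; rewrite !outgoing_rotate.
Qed.

End Rotation.

(** * Complex exponential and logarithm *)

Section ComplexExponential.
Variable R : realType.
Implicit Types z w : R[i].

Lemma Cexp0 : Cexp (0 : R[i]) = 1.
Proof. by rewrite /Cexp /= expR0 cos0 sin0 mulr1 mulr0. Qed.

Lemma CexpD z w : Cexp (z + w) = Cexp z * Cexp w.
Proof.
case: z w => [a b] [c d]; rewrite /Cexp /= expRD cosD sinD.
by apply/eqP; rewrite eq_complex /=; apply/andP; split; apply/eqP; ring.
Qed.

Lemma Cexp_neq0 z : Cexp z != 0.
Proof.
apply: contra_eq_neq Cexp0 => z0; rewrite -(subrr z) CexpD z0 mul0r.
by rewrite eq_sym oner_neq0.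
Qed.

Lemma CexpN z : Cexp (- z) = (Cexp z)^-1.
Proof.
by apply: (mulIf (Cexp_neq0 z)); rewrite -CexpD addNr Cexp0 mulVf ?Cexp_neq0.
Qed.

Lemma CexpMn z n : Cexp (z * n%:R) = Cexp z ^+ n.
Proof.
elim: n => [|n IH]; first by rewrite mulr0 Cexp0.
by rewrite -natr1 mulrDr mulr1 CexpD IH exprSr.
Qed.

Lemma CexpMz z (n : int) : Cexp (z * n%:~R) = Cexp z ^ n.
Proof.
case: n => n; first exact: CexpMn.
by rewrite NegzE rmorphN mulrN CexpN CexpMn.
Qed.

Lemma Cexp_sum (I : finType) (g : I -> R[i]) : Cexp (\sum_i g i) = \prod_i Cexp (g i).
Proof. exact: (big_morph _ CexpD Cexp0). Qed.

Lemma Cexp_pi_i : Cexp (pi_i : R[i]) = -1.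
Proof.
by rewrite /Cexp /= expR0 cospi sinpi mulr0; apply/eqP; rewrite eq_complex /= !mul1r oppr0 !eqxx.
Qed.

(** The principal argument is odd except on the negative axis, where it is [pi]
    for a number and for its inverse. *)
Lemma Clog_inv w : w != 0 ->
  exists n : nat, Clog w^-1 = - Clog w + pi_i * (2 * n)%:R.
Proof.
case: w => a b; rewrite eq_complex /= negb_and => ab0.
pose m : R := a ^+ 2 + b ^+ 2.
have m0 : 0 < m.
  by rewrite /m lt_def paddr_eq0 ?sqr_ge0 // !sqrf_eq0 negb_and ab0 addr_ge0 ?sqr_ge0.
have mne : m != 0 by rewrite gt_eqF.
have s0 : 0 < Num.sqrt m by rewrite sqrtr_gt0.
have winv : ((a +i* b)^-1 = (a / m) +i* - (b / m))%C by [].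
have modinv : Cmod (a / m +i* - (b / m))%C = (Num.sqrt m)^-1.
  rewrite /Cmod /= -sqrtrV ?ltW //; congr Num.sqrt.
  by rewrite /m in mne *; field.
have ratio : a / m / (Num.sqrt m)^-1 = a / Num.sqrt m.
  by rewrite -{1}(sqr_sqrtr (ltW m0)); field; rewrite gt_eqF.
pose t := acos (a / Num.sqrt m).
have argE : Carg (a +i* b)%C = if 0 <= b then t else - t by [].
have arginvE : Carg (a / m +i* - (b / m))%C = if b <= 0 then t else - t.
  by rewrite /Carg modinv /= ratio oppr_ge0 pmulr_lle0 ?invr_gt0.
have logE n : (Carg (a / m +i* - (b / m))%C = - Carg (a +i* b)%C + pi * (2 * n)%:R) ->
    Clog (a +i* b)^-1%C = - Clog (a +i* b)%C + pi_i * (2 * n)%:R.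
  move=> e; rewrite winv /Clog modinv e lnV // -(rmorph_nat (real_complex R)).
  by apply/eqP; rewrite eq_complex /= !mul0r mulr0 subr0 addr0 add0r !eqxx.
have [b_gt0|b_lt0|b0] := ltrgt0P b.
- exists 0%N; apply: logE; rewrite arginvE argE leNgt b_gt0 ltW //=.
  by rewrite muln0 mulr0 addr0.
- exists 0%N; apply: logE; rewrite arginvE argE [0 <= b]leNgt b_lt0 ltW //=.
  by rewrite muln0 mulr0 addr0 opprK.
(* A real number has argument 0 or pi. *)
have : t = 0 \/ t = pi.
  rewrite b0 eqxx orbF in ab0.
  have sa : Num.sqrt m = `|a| by rewrite /m b0 expr0n addr0 sqrtr_sqr.
  rewrite /t sa; have [a_gt0|a_lt0|a0] := ltrgt0P a.
  - by left; rewrite divff ?acos1 ?gt_eqF.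
  - by right; rewrite invrN mulrN divff ?acosN1 ?lt_eqF.
  - by rewrite a0 eqxx in ab0.
case=> tE; [exists 0%N | exists 1%N]; apply: logE; rewrite arginvE argE b0 lexx tE.
  by rewrite oppr0 muln0 mulr0 addr0.
by rewrite muln1; ring.
Qed.

End ComplexExponential.

(** * The exponent of the symmetrization factor *)

Lemma bsign2 (s : 'S_4) : bsign s * bsign s = 1.
Proof. by rewrite /bsign; case: odd_perm. Qed.

Section Pairing.
Variables (T : gluing) (F : numFieldType).
Implicit Types (u v : tet T -> 'I_3 -> F) (b : tet T -> 'S_4).

Definition pairing u v : F := \sum_d (u d 0 * v d 1 - u d 1 * v d 0).

Lemma pairing_wedge b u v : pairing u v =
  \sum_d wedge (b d) (on_edge b u d) (fun A => (bsign (b d))%:~R * on_edge b v d A).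
Proof.
apply: eq_bigr => d _.
rewrite (wedge_on_edge b u (fun d j => (bsign (b d))%:~R * v d j)) !(mulrCA _ (bsign _)%:~R).
by rewrite -mulrBr mulrA -rmorphM bsign2 mul1r.
Qed.

Lemma pairingBl u u' v : pairing u v - pairing u' v = pairing (fun d j => u d j - u' d j) v.
Proof. by rewrite /pairing -sumrB; apply: eq_bigr => d _; ring. Qed.

Lemma pairing_rewritten b b' u v u' v' :
  (forall d i, induced b d i = induced b' d i) ->
  (forall d (A : {set 'I_4}), #|A| = 2%N -> on_edge b' u' d A = on_edge b u d A) ->
  (forall d (A : {set 'I_4}), #|A| = 2%N ->
    (bsign (b' d))%:~R * on_edge b' v' d A = (bsign (b d))%:~R * on_edge b v d A) ->
  pairing u v = pairing u' v'.
Proof.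
move=> bb uu vv; rewrite (pairing_wedge b) (pairing_wedge b'); apply: eq_bigr => d _.
have out i : outgoing (b' d) i = outgoing (b d) i by rewrite -[LHS]bb.
rewrite -(wedge_outgoing _ _ out); last 2 first.
- exact: on_edge_opposite.
- exact: (on_edge_opposite b (fun d j => (bsign (b d))%:~R * v d j)).
have c12 (s : 'S_4) : #|[set s 1; s 2]| = 2%N by rewrite cards2 perm4_neq.
by rewrite /wedge -!uu -?vv ?c12 ?card_edge.
Qed.

End Pairing.

Section Rewriting.
Variables (R : realType) (T : gluing).
Implicit Types (Q : QH_triangulation R T).

Lemma logb_vertex_sum0 Q : vertex_sum0 (on_edge (br Q) (logb (wq Q) (fq Q))).
Proof. exact: on_edge_vertex_sum0 (fq_sum Q). Qed.

(** When the sign of a tetrahedron changes, its shape parameters are inverted.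
    Inverting a logarithm is compatible with negation except on the negative
    axis, where it adds [2 pi i]; as the three log branches add up to zero both
    before and after, such a jump cannot occur. *)
Lemma slogb_rewritten Q Q' : rewritten Q Q' -> forall d (A : {set 'I_4}), #|A| = 2%N ->
  slogb (br Q') (wq Q') (fq Q') d A = slogb (br Q) (wq Q) (fq Q) d A.
Proof.
move=> QQ d A A2; have [s ->] := perm4_edge A2.
have signE t : bsign t = 1 \/ bsign t = -1 by rewrite /bsign; case: odd_perm; [right | left].
have w_neq0 (P : QH_triangulation R T) B : on_edge (br P) (wq P) d B != 0.
  by have [] := wq_neq P d (edge_label (br P d) B).
have [same|opp] : bsign (br Q' d) = bsign (br Q d) \/ bsign (br Q' d) = - bsign (br Q d).
- case: (signE (br Q d)) => ->; case: (signE (br Q' d)) => ->; rewrite ?opprK; auto.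
- have [eqw eqf _] := QQ d _ (card_edge s).
  rewrite /slogb same; congr (_ * (Clog _ + _ * _%:~R)).
    move: eqw; rewrite /sshape same.
    by case: (signE (br Q d)) => ->; rewrite ?expr1z // => /invr_inj.
  move: eqf; rewrite /sflat same.
  by case: (signE (br Q d)) => ->; rewrite ?mul1r ?mulN1r // => /oppr_inj.
have jump (t : {perm 'I_4}) : exists n : nat,
    on_edge (br Q') (logb (wq Q') (fq Q')) d [set t 0; t 1] =
    - on_edge (br Q) (logb (wq Q) (fq Q)) d [set t 0; t 1] + pi_i * (2 * n)%:R.
  have [eqw eqf _] := QQ d _ (card_edge t).
  have w_inv : on_edge (br Q') (wq Q') d [set t 0; t 1] =
      (on_edge (br Q) (wq Q) d [set t 0; t 1])^-1.
    move: eqw; rewrite /sshape opp.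
    by case: (signE (br Q d)) => ->; rewrite ?opprK ?expr1z // => <-; rewrite invrK.
  have f_opp : on_edge (br Q') (fq Q') d [set t 0; t 1] =
      - on_edge (br Q) (fq Q) d [set t 0; t 1].
    move: eqf; rewrite /sflat opp.
    by case: (signE (br Q d)) => ->; rewrite ?opprK ?mul1r ?mulN1r // => <-; rewrite opprK.
  have [n logn] := Clog_inv (w_neq0 Q [set t 0; t 1]).
  exists n; rewrite /on_edge /logb -/(on_edge (br Q') (wq Q') d _).
  rewrite -/(on_edge (br Q') (fq Q') d _) w_inv f_opp logn rmorphN /on_edge; ring.
have [n0 j0] := jump s; have [n1 j1] := jump (t12 * s)%g.
have [n2 j2] := jump (t12 * (t23 * s))%g.
rewrite !(swap12E, swap23E) in j1 j2.
have sum0 : pi_i * (2 * (n0 + n1 + n2))%:R = 0 :> R[i].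
  have := logb_vertex_sum0 Q' d s; rewrite j0 j1 j2 => sum'.
  have sum := logb_vertex_sum0 Q d s.
  by have := congr2 +%R sum' sum; rewrite addr0 => <-; rewrite !natrM !natrD; ring.
have n00 : n0 = 0%N.
  move/eqP: sum0; rewrite mulf_eq0 pnatr_eq0 eq_complex /= eqxx gt_eqF ?pi_gt0 //=.
  by case: (n0).
by rewrite /slogb opp j0 n00 muln0 mulr0 addr0 rmorphN mulrNN.
Qed.

End Rewriting.

Section AlphaExponent.
Variables (R : realType) (T : gluing).
Implicit Types (b : tet T -> 'S_4) (w : tet T -> 'I_3 -> R[i]) (f c : tet T -> 'I_3 -> int).

Definition intC c : tet T -> 'I_3 -> R[i] := fun d j => (c d j)%:~R.

Lemma pairing_int c f : exists k : int, pairing (intC c) (intC f) = k%:~R.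
Proof.
exists (\sum_d (c d 0 * f d 1 - c d 1 * f d 0)); rewrite rmorph_sum /=.
by apply: eq_bigr => d _; rewrite rmorphB !rmorphM.
Qed.

(** Because [N + 1] is congruent to 1 modulo [N], the power [1/N] of the shape
    parameters is, up to a sign, the exponential of the log branch over [N], and
    the charges contribute [c0 c1 - c1 c0 = 0]. *)
Lemma alphaE N b w f c : (0 < N)%N -> alpha N b w f c =
  Cexp (((N.-1)./2)%:R / N%:R * pairing (intC c) (logb w f)
        + pi_i * (((N.-1)./2)%:R * pairing (intC c) (intC f))).
Proof.
move=> N0; have N0' : N%:R != 0 :> R[i] by rewrite pnatr_eq0 -lt0n.
rewrite /pairing !mulr_sumr -big_split /= Cexp_sum /alpha.
apply: eq_bigr => d _; rewrite /wroot -!CexpMz -CexpD -CexpMn; congr Cexp.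
rewrite /intC /logb !rmorphB !rmorphM rmorphN /= -(natr1 N).
by field.
Qed.

End AlphaExponent.

Section AlphaRel.
Variables (R : realType) (T : gluing) (N : nat).
Hypothesis N0 : (0 < N)%N.
Implicit Types (Q : QH_triangulation R T) (c : tet T -> 'I_3 -> int).

Definition charge_diff c c0 : tet T -> 'I_3 -> R[i] := fun d j => intC R c d j - intC R c0 d j.

Lemma alpha_rewritten Q Q' c c' :
  (forall d i, induced (br Q) d i = induced (br Q') d i) ->
  rewritten Q Q' -> rewritten_charge (br Q) (br Q') c c' ->
  alpha N (br Q) (wq Q) (fq Q) c = alpha N (br Q') (wq Q') (fq Q') c'.
Proof.
move=> ind QQ cc.
have cE d (A : {set 'I_4}) : #|A| = 2%N ->
    on_edge (br Q') (intC R c') d A = on_edge (br Q) (intC R c) d A.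
  by move=> A2; have := cc d A A2; rewrite /on_edge /intC => ->.
have eql : pairing (intC R c) (logb (wq Q) (fq Q)) = pairing (intC R c') (logb (wq Q') (fq Q')).
  by apply: (pairing_rewritten ind cE) => d A A2; apply: slogb_rewritten QQ _ _ A2.
have eqf : pairing (intC R c) (intC R (fq Q)) = pairing (intC R c') (intC R (fq Q')).
  apply: (pairing_rewritten ind cE) => d A A2.
  have [_ /(congr1 (fun k : int => k%:~R : R[i])) e _] := QQ d A A2.
  by move: e; rewrite /sflat !rmorphM.
by rewrite (alphaE _ _ _ _ N0) (alphaE (br Q') _ _ _ N0) eql eqf.
Qed.

Lemma alpha_relE Q c0 : exists k : int, alpha_rel N Q c0 =
  Cexp (((N.-1)./2)%:R / N%:R * pairing (charge_diff (cq Q) c0) (logb (wq Q) (fq Q))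
        + pi_i * k%:~R).
Proof.
have [k ek] := pairing_int R (cq Q) (fq Q); have [k0 ek0] := pairing_int R c0 (fq Q).
exists (((N.-1)./2)%:Z * (k - k0)); rewrite /alpha_rel !alphaE // -CexpN -CexpD.
congr Cexp; rewrite -pairingBl ek ek0 rmorphM rmorphB /=; ring.
Qed.

End AlphaRel.

(** * Dependence on the boundary weights *)

Section Independence.
Variables (R : realType) (T : gluing).
Implicit Types (Q : QH_triangulation R T) (b : tet T -> 'S_4) (c : tet T -> 'I_3 -> int).

Lemma charge_diff_vertex_sum0 b c c0 : charge b c -> charge b c0 ->
  vertex_sum0 (on_edge b (charge_diff R c c0)).
Proof.
move=> [c1 _] [c01 _]; apply: on_edge_vertex_sum0 => d.
rewrite /charge_diff /intC -!rmorphB -!rmorphD /=.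
have -> : c d 0 - c0 d 0 + (c d 1 - c0 d 1) + (c d 2 - c0 d 2) =
   (c d 0 + c d 1 + c d 2) - (c0 d 0 + c0 d 1 + c0 d 2) by ring.
by rewrite c1 c01 subrr.
Qed.

Lemma charge_diff_edge_sum0 b c c0 : charge b c -> charge b c0 ->
  edge_sum0 (on_edge b (charge_diff R c c0)).
Proof.
move=> [_ c2] [_ c02] x x2.
have := congr1 (fun k : int => k%:~R : R[i]) (congr2 (fun k l => k - l) (c2 x x2) (c02 x x2)).
rewrite subrr rmorph0 rmorphB !rmorph_sum /= => sum0; rewrite -[RHS]sum0 -sumrB.
by apply: eq_bigr => y _; rewrite /on_edge /charge_diff /intC.
Qed.

Lemma vertex_sum0B (X X' : tet T -> {set 'I_4} -> R[i]) :
  vertex_sum0 X -> vertex_sum0 X' -> vertex_sum0 (fun d A => X d A - X' d A).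
Proof.
move=> X0 X0' d s; have := congr2 (fun y z => y - z) (X0 d s) (X0' d s).
by rewrite /= subrr => sum0; rewrite -[RHS]sum0; ring.
Qed.

Lemma slogb_vertex_sum0 Q : vertex_sum0 (slogb (br Q) (wq Q) (fq Q)).
Proof. by move=> d s; rewrite /slogb -!mulrDr logb_vertex_sum0 mulr0. Qed.

Lemma slogb_opposite Q : opposite_eq (slogb (br Q) (wq Q) (fq Q)).
Proof. by move=> d s; rewrite /slogb on_edge_opposite. Qed.

Lemma same_kc_diff_loop_sum0 b b' c c0 c' c0' :
  same_kc_diff b c c0 b' c' c0' -> forall C : seq (Defs.arc T), normal_loop C ->
  \sum_(a <- C) (bsign a.2)%:~R * (on_edge b (charge_diff R c c0) a.1 (arc_edge a)
    - on_edge b' (charge_diff R c' c0') a.1 (arc_edge a)) = 0.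
Proof.
move=> kc C lC.
have /eqP := kc C lC; rewrite -subr_eq0 /weight_kc -!sumrB.
move/eqP/(congr1 (fun k : int => k%:~R : R[i])); rewrite rmorph0 rmorph_sum /= => sum0.
rewrite -[RHS]sum0; apply: eq_bigr => a _.
rewrite !rmorphB !rmorphM /on_edge /charge_diff /intC /=; ring.
Qed.

(** Moving from one pair of decorations to the other changes first the charge,
    then the log branches; each change has no boundary holonomy, hence pairs
    trivially with the other variable. *)
Lemma pairing_holonomy Q Q' c0 c0' :
  charge (br Q) c0 -> charge (br Q') c0' ->
  (forall d i, induced (br Q) d i = induced (br Q') d i) -> same_kf Q Q' ->
  same_kc_diff (br Q) (cq Q) c0 (br Q') (cq Q') c0' ->
  pairing (charge_diff R (cq Q) c0) (logb (wq Q) (fq Q)) =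
  pairing (charge_diff R (cq Q') c0') (logb (wq Q') (fq Q')).
Proof.
move=> ch ch' ind kf kc.
rewrite (pairing_wedge (br Q)) (pairing_wedge (br Q')).
pose X := on_edge (br Q) (charge_diff R (cq Q) c0).
pose X' := on_edge (br Q') (charge_diff R (cq Q') c0').
pose Y := slogb (br Q) (wq Q) (fq Q).
pose Y' := slogb (br Q') (wq Q') (fq Q').
change (\sum_d wedge (br Q d) (X d) (Y d) = \sum_d wedge (br Q' d) (X' d) (Y' d)).
have Yo' : opposite_eq Y' := slogb_opposite Q'.
have Xo' : opposite_eq X' by apply: on_edge_opposite.
transitivity (\sum_d wedge (br Q d) (X' d) (Y' d)); last first.
  apply: eq_bigr => d _; apply/esym/wedge_outgoing; [exact: Xo' | exact: Yo' |].
  by move=> i; rewrite -[LHS]ind.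
have sum1 : \sum_d wedge (br Q d) (fun A => X d A - X' d A) (Y d) = 0.
  apply: (@wedge_sum0 T _ (br Q) (fun d A => X d A - X' d A) Y).
  - exact: vertex_sum0B (charge_diff_vertex_sum0 (cq_charge Q) ch)
      (charge_diff_vertex_sum0 (cq_charge Q') ch').
  - exact: same_kc_diff_loop_sum0.
  - exact: slogb_opposite.
  - exact: slogb_vertex_sum0.
  - exact: fq_edge.
have sum2 : \sum_d wedge (br Q d) (fun A => Y d A - Y' d A) (X' d) = 0.
  apply: (@wedge_sum0 T _ (br Q) (fun d A => Y d A - Y' d A) X').
  - exact: vertex_sum0B (slogb_vertex_sum0 Q) (slogb_vertex_sum0 Q').
  - move=> C lC; have := kf C lC; move/eqP; rewrite -subr_eq0 -sumrB => /eqP sum0.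
    by rewrite -[RHS]sum0; apply: eq_bigr => a _; rewrite mulrBr.
  - exact: Xo'.
  - exact: charge_diff_vertex_sum0 (cq_charge Q') ch'.
  - exact: charge_diff_edge_sum0 (cq_charge Q') ch'.
apply/eqP; rewrite -subr_eq0 -sumrB; apply/eqP.
transitivity (\sum_d (wedge (br Q d) (fun A => X d A - X' d A) (Y d)
  - wedge (br Q d) (fun A => Y d A - Y' d A) (X' d))).
  by apply: eq_bigr => d _; rewrite /wedge; ring.
by rewrite sumrB sum1 sum2 subrr.
Qed.

Lemma alpha_rel_holonomy N Q Q' c0 c0' : (0 < N)%N ->
  charge (br Q) c0 -> charge (br Q') c0' ->
  (forall d i, induced (br Q) d i = induced (br Q') d i) -> same_kf Q Q' ->
  same_kc_diff (br Q) (cq Q) c0 (br Q') (cq Q') c0' ->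
  exists2 z : R[i], z ^+ 4 = 1 & alpha_rel N Q c0 = z * alpha_rel N Q' c0'.
Proof.
move=> N0 ch ch' ind kf kc.
have [k ->] := alpha_relE N0 Q c0; have [k' ->] := alpha_relE N0 Q' c0'.
exists (Cexp (pi_i * (k - k')%:~R)).
  by rewrite CexpMz Cexp_pi_i exprnP exprz_exp mulrC -exprz_exp -exprnP -signr_odd expr0 exp1rz.
by rewrite (pairing_holonomy ch ch' ind kf kc) -CexpD rmorphB /=; congr Cexp; ring.
Qed.

End Independence.

Theorem theorem1p10 (R : realType) (N : nat) (T : ideal_triangulation)
    (d0 : tet T) (N_ge3 : (3 <= N)%N) (N_odd : odd N) :
  (forall (Q Q' : QH_triangulation R T) (c0 c0' : tet T -> 'I_3 -> int),
     charge (br Q) c0 -> charge (br Q') c0' ->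
     (forall d i, induced (br Q) d i = induced (br Q') d i) ->
     rewritten Q Q' -> rewritten_charge (br Q) (br Q') c0 c0' ->
     alpha_rel N Q c0 = alpha_rel N Q' c0')
  /\
  (forall (Q Q' : QH_triangulation R T) (c0 c0' : tet T -> 'I_3 -> int),
     charge (br Q) c0 -> charge (br Q') c0' ->
     (forall d i, induced (br Q) d i = induced (br Q') d i) ->
     same_encoding d0 Q Q' -> same_c_weights (br Q) c0 (br Q') c0' ->
     exists2 z : R[i], z ^+ 4 = 1 & alpha_rel N Q c0 = z * alpha_rel N Q' c0')
  /\
  (forall (Q Q' : QH_triangulation R T) (c0 c0' : tet T -> 'I_3 -> int),
     charge (br Q) c0 -> charge (br Q') c0' ->
     (forall d i, induced (br Q) d i = induced (br Q') d i) ->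
     same_kf Q Q' ->
     same_kc_diff (br Q) (cq Q) c0 (br Q') (cq Q') c0' ->
     exists2 z : R[i], z ^+ 4 = 1 & alpha_rel N Q c0 = z * alpha_rel N Q' c0').
Proof.
have N0 : (0 < N)%N by apply: leq_trans N_ge3.
split; last split.
- move=> Q Q' c0 c0' ch ch' ind QQ cc; rewrite /alpha_rel.
  have cq_cq : rewritten_charge (br Q) (br Q') (cq Q) (cq Q').
    by move=> d A A2; have [_ _] := QQ d A A2.
  by rewrite (alpha_rewritten N0 ind QQ cc) (alpha_rewritten N0 ind QQ cq_cq).
- move=> Q Q' c0 c0' ch ch' ind [_ _ [kf kc]] [_ kc0].
  apply: alpha_rel_holonomy => // C lC; by rewrite kc ?kc0.
- by move=> Q Q' c0 c0' ch ch' ind kf kc; apply: alpha_rel_holonomy.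
Qed.
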